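(* Let $(T,d)$ be a compact metric space, $\Sigma$ its Borel $\sigma$-algebra, $\mu:\Sigma\to[0,\infty)$ a regular, countably additive, pointwise non atomic measure, and $X$ a Banach space. Let $F:T\to cwk(X)$ be any H-integrable multifunction, and set $M(E):=\Phi(F,E)$ for $E\in\Sigma$. Then $M$ is a countably additive multimeasure. Moreover, in the topology of $C(\Omega)$, $M$ is $\sigma$-additive and $\mu$-absolutely continuous; that is, the set function $E\mapsto i(M(E))\in C(\Omega)$ is $\sigma$-additive and $\mu$-absolutely continuous with respect to the norm $\|\cdot\|_\infty$, where $i:cwk(X)\to C(\Omega)$ is the embedding described in the context.
   Context: Pointwise non atomic means $\mu(\{t\})=0$ for every $t\in T$. $cwk(X)$ is the family of all non-empty convex weakly compact subsets of $X$; $d_H$ is the Hausdorff distance. A gauge is any map $\gamma:T\to(0,\infty)$. For $E\in\Sigma$, a partition of $E$ is a finite family $\Pi=\{(E_i,t_i):i=1,\dots,k\}$ with $t_i\in T$, $E_i\in\Sigma$, $\mu(E_i\cap E_j)=0$ for $i\ne j$, and $\bigcup_i E_i=E$ (the tags $t_i$ need not lie in $E_i$). It is $\gamma$-fine if $d(w,t_i)<\gamma(t_i)$ for every $w\in E_i$ and every $i$. Write $\sum_\Pi F=\sum_i \mu(E_i)F(t_i)$ (Minkowski sum). $F:T\to cwk(X)$ is H-integrable if there is $J\in cwk(X)$ such that for every $\varepsilon>0$ there is a gauge $\gamma$ with $d_H(\sum_{\Pi}F,J)\le\varepsilon$ for every $\gamma$-fine partition $\Pi$ of $T$. $\Phi(F,E)$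 is the set of all $z\in X$ such that for every $\varepsilon>0$ there is a gauge $\gamma$ with $\inf_{c\in\sum_{\Pi}F}\|z-c\|\le\varepsilon$ for every $\gamma$-fine partition $\Pi$ of $E$. (For H-integrable $F$, $\Phi(F,E)\in cwk(X)$ for every $E\in\Sigma$.) A map $M:\Sigma\to cwk(X)$ is a countably additive multimeasure if $M(\emptyset)=\{0\}$ and, for every disjoint sequence $(E_n)$ in $\Sigma$, the series $\sum_n M(E_n)$ is unconditionally convergent (i.e. for every choice $x_n\in M(E_n)$ the series $\sum_n x_n$ converges unconditionally in $X$) and $M(\bigcup_n E_n)=\sum_n M(E_n):=\{\sum_n x_n: x_n\in M(E_n)\}$. Embedding (known theorem): there exist a compact Hausdorff space $\Omega$ and a positively linear map $i:cwk(X)\to C(\Omega)$ such that $d_H(A,C)=\|i(A)-i(C)\|_\infty$ for all $A,C\in cwk(X)$; $i(cwk(X))$ is norm closed; and $i(\overline{\mathrm{co}}(A\cup C))=\max\{i(A),i(C)\}$ for all $A,C\in cwk(X)$. Fix such $\Omega$ and $i$. *)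

(* Defs.v *)
From HB Require Import structures.
From mathcomp Require Import all_boot all_order all_algebra.
From mathcomp Require Import all_classical all_reals all_analysis.

Set Implicit Arguments.
Unset Strict Implicit.
Unset Printing Implicit Defensive.

Import Order.TTheory GRing.Theory Num.Theory.
Import numFieldNormedType.Exports.

Local Open Scope classical_set_scope.
Local Open Scope ring_scope.

                                                                         
                                                         
#[short(type="pmetricType")]
HB.structure Definition PMetric (K : numDomainType) :=
  {M of Metric K M & Pointed M}.

Notation borel T := (g_sigma_algebraType (@open T)).

Section weak_compactness.
Context {R : realType} (X : normedModType R).

Definition dual := {f : {scalar X} | continuous (f : X -> R)}.

                                                                       
                
Definition weak_space : topologicalType :=
  sup_topology (fun f : dual =>
    Topological.on (initial_topology (sval f : X -> R))).

Definition cwk (A : set X) : Prop :=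
  [/\ A !=set0, convex_set (A : set (convex_lmodType X)) &
      compact (A : set weak_space)].

End weak_compactness.
Arguments cwk {R X}.

Section set_operations.
Context {R : realType} {X : normedModType R}.
Implicit Types A C : set X.

Definition minkowski_add A C : set X := [set a + c | a in A & c in C].

Definition minkowski_scale (r : R) A : set X := [set r *: a | a in A].

Definition closed_convex_hull A : set X :=
  smallest [set C : set X |
    convex_set (C : set (convex_lmodType X)) /\ closed C] A.

                                                                         
                                           
Definition set_dist (z : X) C : \bar R := ereal_inf [set `|z - c|%:E | c in C].

Definition hausdorff_dist A C : \bar R :=
  maxe (ereal_sup [set set_dist a C | a in A])
       (ereal_sup [set set_dist c A | c in C]).

End set_operations.

Section measure_hypotheses.
Context {R : realType} {T : pmetricType R}.
Variable mu : set (borel T) -> \bar R.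

Definition regular_measure : Prop :=
  forall E : set (borel T), measurable E ->
    mu E = ereal_inf [set mu U | U in [set U : set T | open U /\ E `<=` U]] /\
    mu E = ereal_sup [set mu K | K in [set K : set T | compact K /\ K `<=` E]].

Definition pointwise_nonatomic : Prop := forall t : T, mu [set t] = 0%E.

End measure_hypotheses.

Section integral.
Context {R : realType} {T : pmetricType R} {X : normedModType R}.
Variable mu : {finite_measure set (borel T) -> \bar R}.
Variable F : T -> set X.

Definition gauge_fun (gamma : T -> R) : Prop := forall t, 0 < gamma t.

                                                                         
          
Definition partition_of (E : set (borel T)) k
    (P : 'I_k -> set (borel T) * T) : Prop :=
  [/\ forall i, measurable (P i).1,
      forall i j, i != j -> mu ((P i).1 `&` (P j).1) = 0%E &
      \bigcup_i (P i).1 = E].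

Definition fine_partition (gamma : T -> R) k
    (P : 'I_k -> set (borel T) * T) : Prop :=
  forall i (w : T), (P i).1 w -> mdist w (P i).2 < gamma (P i).2.

Definition riemann_sum k (P : 'I_k -> set (borel T) * T) : set X :=
  \big[minkowski_add/[set 0]]_(i < k)
    minkowski_scale (fine (mu (P i).1)) (F (P i).2).

Definition H_integrable : Prop :=
  exists2 J : set X, cwk J &
    forall eps : R, 0 < eps ->
      exists2 gamma : T -> R, gauge_fun gamma &
        forall k (P : 'I_k -> set (borel T) * T),
          partition_of setT P -> fine_partition gamma P ->
          (hausdorff_dist (riemann_sum P) J <= eps%:E)%E.

Definition Phi (E : set (borel T)) : set X :=
  [set z | forall eps : R, 0 < eps ->
      exists2 gamma : T -> R, gauge_fun gamma &
        forall k (P : 'I_k -> set (borel T) * T),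
          partition_of E P -> fine_partition gamma P ->
          (set_dist z (riemann_sum P) <= eps%:E)%E].

End integral.

Section multimeasure.
Context {R : realType} {d : measure_display} {T : measurableType d}.
Context {X : normedModType R}.

Definition unconditionally_cvg (x : nat -> X) : Prop :=
  forall p : nat -> nat, bijective p -> cvgn (series (x \o p)).

Definition multimeasure (M : set T -> set X) : Prop :=
  [/\ forall E, measurable E -> cwk (M E),
      M set0 = [set 0] &
      forall E : nat -> set T, (forall n, measurable (E n)) ->
        trivIset setT E ->
        (forall x : nat -> X, (forall n, M (E n) (x n)) ->
          unconditionally_cvg x) /\
        M (\bigcup_n E n) =
          [set limn (series x) | x in [set x | forall n, M (E n) (x n)]]].

End multimeasure.

Section continuous_functions.
Context {R : realType} {Omega : topologicalType}.

                                                                            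
                                                 
Definition sup_norm (f : Omega -> R) : R := sup (range (fun w => `|f w|)).

                                                                             
Definition embedding (X : normedModType R)
    (i : set X -> continuousType Omega R) : Prop :=
  [/\ forall A C (a c : R), cwk A -> cwk C -> 0 <= a -> 0 <= c ->
        i (minkowski_add (minkowski_scale a A) (minkowski_scale c C))
          = (fun w => a * i A w + c * i C w) :> (Omega -> R),
      forall A C, cwk A -> cwk C ->
        hausdorff_dist A C = (sup_norm (fun w => i A w - i C w))%:E,
      forall f : continuousType Omega R,
        (forall eps : R, 0 < eps ->
          exists2 A, cwk A & sup_norm (fun w => f w - i A w) < eps) ->
        exists2 A, cwk A & i A = f &
      forall A C, cwk A -> cwk C ->
        i (closed_convex_hull (A `|` C))
          = (fun w => Num.max (i A w) (i C w)) :> (Omega -> R)].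

Context {d : measure_display} {T : measurableType d}.
Implicit Type nu : set T -> continuousType Omega R.

Definition sup_norm_sigma_additive nu : Prop :=
  forall E : nat -> set T, (forall n, measurable (E n)) -> trivIset setT E ->
    (fun n => sup_norm (fun w =>
       nu (\bigcup_k E k) w - \sum_(k < n) nu (E k) w)) @ \oo --> (0 : R).

                                                                          
                   
Definition sup_norm_abs_continuous (mu : set T -> \bar R) nu : Prop :=
  forall eps : R, 0 < eps -> exists2 delta : R, 0 < delta &
    forall E, measurable E -> (mu E < delta%:E)%E -> sup_norm (nu E) < eps.

End continuous_functions.

(* Main.v *)
(* For each gauge, completing two fine partitions of E by one and the same fine
   partition of the complement shows that the Riemann sums over E, embedded in
   C(Omega), satisfy a uniform Cauchy condition. Their limit belongs to the
   closed set i(cwk(X)), and the set it represents is Phi(F, E). The limits are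
   additive in E; since a finite set of tags serves all E at once, they are also
   small when mu(E) is small. Additivity and absolute continuity force both the
   sigma-additivity in C(Omega) and, by peeling off one summand at a time, the
   decomposition of Phi(F, U_n E_n) into series of selections. Hahn-Banach makes
   weakly compact sets norm closed, so that d_H separates them. *)
Require Import Defs.
From HB Require Import structures.
From mathcomp Require Import all_boot all_order all_algebra.
From mathcomp Require Import finmap all_classical all_reals all_analysis.
From mathcomp Require Import zify ring lra.
Import Order.TTheory GRing.Theory Num.Theory.
Import numFieldNormedType.Exports.
Local Open Scope classical_set_scope.
Local Open Scope ring_scope.

(** * Separation by norm-continuous functionals and weakly compact sets *)

Section hahn_banach.
Context {R : realType} {X : normedModType R}.
Implicit Types (G : set (X * R)) (x v w : X).

(** A partial linear functional is encoded by its graph, so that the upper bound of a chain is a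
    plain union. The one-sided bound suffices, since at [- v] it gives the other side. *)
Definition dominated_graph G :=
  (forall (a b : R) p q, G p -> G q ->
     G (a *: p.1 + b *: q.1, a * p.2 + b * q.2)) /\
  (forall p, G p -> p.2 <= `|p.1|).

(** The graph contains [(0, r - s)] and its negative, and domination makes both second components at
    most 0. *)
Lemma dominated_graph_uniq {G v} {r s : R} :
  dominated_graph G -> G (v, r) -> G (v, s) -> r = s.
Proof.
move=> [lin dom] Gr Gs.
have := dom _ (lin 1 (-1) _ _ Gr Gs); have := dom _ (lin (-1) 1 _ _ Gr Gs).
rewrite /= !scaleN1r !scale1r addNr subrr normr0 => ? ?; lra.
Qed.

(** One-step extension of Hahn-Banach. The value at [y] must lie above every [p.2 - |p.1 - y|] and
    below every [|q.1 + y| - q.2]. The triangle inequality separates the two families, so the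
    supremum of the first is a valid choice. *)
Lemma dominated_graph_extend {G} (y : X) :
  dominated_graph G -> G !=set0 ->
  exists c : R, dominated_graph [set (p.1.1 + p.2 *: y, p.1.2 + p.2 * c) |
    p in [set p : (X * R) * R | G p.1]].
Proof.
move=> [lin dom] [p0 Gp0].
pose S := [set p.2 - `|p.1 - y| | p in G].
have ub q : G q -> ubound S (`|q.1 + y| - q.2).
  move=> Gq _ [p Gp <-].
  have := dom _ (lin 1 1 _ _ Gp Gq); rewrite /= !scale1r !mul1r => h.
  have : `|p.1 + q.1| <= `|p.1 - y| + `|q.1 + y|.
    have -> : p.1 + q.1 = (p.1 - y) + (q.1 + y) by rewrite addrACA addNr addr0.
    exact: ler_normD.
  move=> ?; lra.
have supS : has_sup S.
  split; first by exists (p0.2 - `|p0.1 - y|), p0.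
  by exists (`|p0.1 + y| - p0.2); exact: ub.
have low q : G q -> q.2 - sup S <= `|q.1 - y|.
  move=> Gq; have : q.2 - `|q.1 - y| <= sup S.
    by apply: ub_le_sup; [exact: supS.2|exists q].
  move=> ?; lra.
have upp q : G q -> q.2 + sup S <= `|q.1 + y|.
  move=> Gq; have : sup S <= `|q.1 + y| - q.2.
    by apply: ge_sup; [exact: supS.1|exact: ub].
  move=> ?; lra.
exists (sup S); split.
  move=> a b _ _ [[p s] /= Gp <-] [[q t] /= Gq <-] /=.
  exists ((a *: p.1 + b *: q.1, a * p.2 + b * q.2), a * s + b * t) => /=.
    exact: lin.
  congr pair; last by ring.
  by rewrite !scalerDr scalerDl !scalerA addrACA.
have scale t p : t != 0 -> G p -> G (t^-1 *: p.1, t^-1 * p.2).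
  by move=> t0 Gp; have := lin t^-1 0 _ _ Gp Gp; rewrite !scale0r !mul0r !addr0.
(* Dividing by [|t|] reduces domination to [t = 1] and [t = -1], which are [upp] and [low]. *)
move=> _ [[p t] /= Gp <-] /=; case: (ltrgt0P t) => [t0|t0|->].
- have := upp _ (scale t p (lt0r_neq0 t0) Gp) => /=.
  rewrite -(ler_pM2l t0) -{3}(gtr0_norm t0) -normrZ !scalerDr mulrDr.
  by rewrite scalerA mulrA mulfV ?gt_eqF// scale1r mul1r.
- have nt0 : 0 < - t by rewrite oppr_gt0.
  have := low _ (scale (- t) p (lt0r_neq0 nt0) Gp) => /=.
  rewrite -(ler_pM2l nt0) -{3}(gtr0_norm nt0) -normrZ scalerBr mulrBr.
  rewrite scalerA mulrA mulfV ?gt_eqF// scale1r mul1r.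
  by rewrite scaleNr opprK mulNr opprK.
- by rewrite scale0r mul0r !addr0; exact: dom.
Qed.

Lemma dominated_graph_bigcup (F : set (set (X * R))) :
  F `<=` dominated_graph -> total_on F subset ->
  dominated_graph (\bigcup_(G in F) G).
Proof.
move=> FP tot; split=> [a b p q [G FG Gp] [H FH Hq]|p [G FG Gp]]; last first.
  exact: (FP _ FG).2.
have [GH|HG] := tot _ _ FG FH.
  by exists H => //; apply: (FP _ FH).1 => //; exact: GH.
by exists G => //; apply: (FP _ FG).1 => //; exact: HG.
Qed.

(** The functional sending [t *: x] to [t * |x|] on the line through [x] extends to all of [X] under
    the same norm bound, and its value at [x] is [|x|]. *)
Lemma dual_separates (x : X) : (forall f : dual X, sval f x = 0) -> x = 0.
Proof.
move=> fx0; apply: contrapT => /eqP x0.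
pose G0 : set (X * R) := [set (t *: x, t * `|x|) | t in setT].
have G0dom : dominated_graph G0.
  split=> [a b _ _ [s _ <-] [t _ <-]|_ [t _ <-]]/=.
    by exists (a * s + b * t) => //; rewrite scalerDl !scalerA mulrDl !mulrA.
  by rewrite normrZ ler_wpM2r// ler_norm.
(* Zorn's lemma must also serve the empty chain, whose union is the empty graph; hence only
   non-empty graphs are required to contain [G0]. *)
pose P : set (set (X * R)) :=
  [set G | dominated_graph G /\ (G !=set0 -> G0 `<=` G)].
have [F FP tot|G [[Gdom GG0'] Gmax]] := @Zorn_bigcup _ P.
  split; first by apply: dominated_graph_bigcup => // G /FP[].
  by move=> [p [G FG Gp]]; apply: (subset_trans _ (bigcup_sup FG));
    apply: (FP _ FG).2; exists p.
have GG0 : G0 `<=` G.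
  apply: GG0'; apply/set0P/negP => /eqP G_0.
  have PG0 : P G0 by split=> // _; exact: subset_refl.
  apply: (Gmax G0) PG0.
  rewrite G_0; split; first exact: sub0set.
  by move/(_ (0 *: x, 0 * `|x|)); apply; exists 0.

have Gne : G !=set0 by exists (0 *: x, 0 * `|x|); apply: GG0; exists 0.
(* Maximality makes the functional total: otherwise the extension at [v] would be strictly larger,
   as it contains a pair over [v]. *)
have Gtot v : exists r, G (v, r).
  apply: contrapT => Gv.
  have [c Hdom] := dominated_graph_extend v Gdom Gne.
  set H := (X in dominated_graph X) in Hdom.
  have GH : G `<=` H.
    by move=> [w r] Gw; exists ((w, r), 0); rewrite //= scale0r mul0r !addr0.
  apply: (Gmax H); last by split => // _; exact: subset_trans GH.
  split=> // /(_ (v, 0 + 1 * c)) HG; apply: Gv; exists (0 + 1 * c); apply: HG.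
  exists ((0, 0), 1) => /=; last by rewrite scale1r add0r.
  by have := GG0 (0 *: x, 0 * `|x|); rewrite scale0r mul0r; apply; exists 0;
    rewrite ?scale0r ?mul0r.
pose f v : R := sval (cid (Gtot v)).
have Gf v : G (v, f v) by rewrite /f; case: cid.
have flin : scalar f.
  move=> a v w; apply: (dominated_graph_uniq Gdom (Gf _)).
  by have := Gdom.1 a 1 _ _ (Gf v) (Gf w); rewrite /= scale1r mul1r.
pose fL := GRing.isLinear.Build R X R *%R f flin.
pose g : {scalar X} := HB.pack f fL.
have gc : continuous (g : X -> R).
  apply: (@bounded_linear_continuous R X R g); apply/bounded_funP => r.
  exists r => v vr; apply: le_trans vr.
  rewrite ler_norml; apply/andP; split; last exact: (Gdom.2 _ (Gf v)).
  have := Gdom.2 _ (Gf (- v)); rewrite /= normrN.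
  by rewrite -[f (- v)]/(g (- v)) linearN/= -lerN2 opprK.
have := fx0 (exist _ g gc); rewrite /= => fx.
have : f x = `|x|.
  apply: (dominated_graph_uniq Gdom (Gf _)); apply: GG0; exists 1 => //.
  by rewrite scale1r mul1r.
by rewrite fx => /esym/normr0P; exact/negP.
Qed.

End hahn_banach.

(** * The weak topology and the stability of [cwk] under Minkowski operations *)

Section weak_topology.
Context {R : realType} {X : normedModType R}.

(** The weak topology is a supremum of initial topologies, so convergence is tested on one
    functional at a time. *)
Lemma continuous_to_weak (Y : topologicalType) (g : Y -> weak_space X) :
  (forall f : dual X, continuous (fun y => sval f (g y) : R)) -> continuous g.
Proof.
move=> gc y; apply/cvg_sup => f.
exact: (@continuous_comp_initial _ _ _ (sval f : X -> R) g (gc f)).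
Qed.

Lemma dual_weak_continuous (f : dual X) :
  continuous (sval f : weak_space X -> R).
Proof.
move=> x; have /cvg_sup/(_ f) := @cvg_id (weak_space X) (nbhs x).
move=> h; apply: (cvg_comp _ _ h).
exact: (@initial_continuous X R (sval f : X -> R)).
Qed.

Lemma weak_hausdorff : hausdorff_space (weak_space X).
Proof.
move=> x y xy; apply/eqP; rewrite -subr_eq0; apply/eqP/dual_separates => f.
rewrite linearB/=; apply/eqP; rewrite subr_eq0; apply/eqP.
apply: (@norm_hausdorff _ R) => A B Afx Bfy.
have [z [Az Bz]] := xy _ _ (dual_weak_continuous f x _ Afx)
  (dual_weak_continuous f y _ Bfy).
by exists (sval f z).
Qed.

(** Weakly compact sets are weakly closed because the weak topology is Hausdorff, and the identity
    from the norm to the weak topology is continuous. *)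
Lemma cwk_closed (A : set X) : cwk A -> closed A.
Proof.
move=> [_ _ cA].
have idc : continuous (id : X -> weak_space X).
  by apply: continuous_to_weak => f; exact: (svalP f).
move/continuous_closedP: idc => /(_ A); apply.
exact: (compact_closed weak_hausdorff).
Qed.

Lemma cwk_set1 (x : X) : cwk [set x].
Proof.
split; [by exists x| |exact: compact_set1].
by move=> a b l /[!inE] -> ->; rewrite convmm.
Qed.

Lemma cwk_minkowski_add (A C : set X) :
  cwk A -> cwk C -> cwk (minkowski_add A C).
Proof.
move=> [[a Aa] Acv cA] [[c Cc] Ccv cC]; split.
- by exists (a + c), a => //; exists c.
- move=> u v l /[!inE] -[a1 Aa1 [c1 Cc1 <-]] [a2 Aa2 [c2 Cc2 <-]].
  exists (conv l (a1 : convex_lmodType X) a2).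
    by apply/set_mem/Acv; exact/mem_set.
  exists (conv l (c1 : convex_lmodType X) c2).
    by apply/set_mem/Ccv; exact/mem_set.
  by rewrite /conv/= !scalerDr addrACA.
(* The sum is the image of the product under addition, which is weakly continuous because every
   functional is additive. *)
- rewrite /minkowski_add (_ : [set _ | _ in _ & _ in _] =
     (fun p : weak_space X * weak_space X => (p.1 : X) + p.2) @` (A `*` C)).
    apply: (@continuous_compact (weak_space X * weak_space X)%type
      (weak_space X));
      last exact: (@compact_setX (weak_space X) (weak_space X)).
    apply: continuous_subspaceT.
    apply: continuous_to_weak => f p; under eq_fun do rewrite linearD/=.
    apply: (@cvgD _ R); apply: continuous_comp; [exact: cvg_fst|..];
      [|exact: cvg_snd|]; exact: dual_weak_continuous.
  apply/seteqP; split=> [_ [u Au [v Cv <-]]|_ [[u v] [Au Cv] <-]].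
    by exists (u, v).
  by exists u => //; exists v.
Qed.

Lemma cwk_minkowski_scale (r : R) (A : set X) :
  cwk A -> cwk (minkowski_scale r A).
Proof.
move=> [[a Aa] Acv cA]; split.
- by exists (r *: a), a.
- move=> u v l /[!inE] -[a1 Aa1 <-] [a2 Aa2 <-].
  exists (conv l (a1 : convex_lmodType X) a2).
    by apply/set_mem/Acv; exact/mem_set.
  by rewrite /conv/= scalerDr !scalerA ![r * _]mulrC.
- rewrite /minkowski_scale.
  apply: (@continuous_compact (weak_space X) (weak_space X)) => //.
  apply: continuous_subspaceT.
  apply: continuous_to_weak => f p; under eq_fun do rewrite linearZ/=.
  exact: (cvgM (cvg_cst r) (dual_weak_continuous f p)).
Qed.

End weak_topology.

(** * Fine partitions *)

Section gauge_integral.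
Context {R : realType} {T : pmetricType R}.
Variable mu : {finite_measure set (borel T) -> \bar R}.
Implicit Types (E : set (borel T)) (gamma : T -> R).

Definition cat_partition {k l} (P : 'I_k -> set (borel T) * T)
    (Q : 'I_l -> set (borel T) * T) (i : 'I_(k + l)) : set (borel T) * T :=
  match fintype.split i with inl a => P a | inr b => Q b end.

Lemma cat_partition_lshift k l (P : 'I_k -> set (borel T) * T)
    (Q : 'I_l -> set (borel T) * T) a :
  cat_partition P Q (lshift l a) = P a.
Proof. by rewrite /cat_partition (unsplitK (inl a)). Qed.

Lemma cat_partition_rshift k l (P : 'I_k -> set (borel T) * T)
    (Q : 'I_l -> set (borel T) * T) b :
  cat_partition P Q (rshift k b) = Q b.
Proof. by rewrite /cat_partition (unsplitK (inr b)). Qed.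

Lemma partition_of_cat E E' k l (P : 'I_k -> set (borel T) * T)
    (Q : 'I_l -> set (borel T) * T) : E `&` E' = set0 ->
  partition_of mu E P -> partition_of mu E' Q ->
  partition_of mu (E `|` E') (cat_partition P Q).
Proof.
move=> EE' [mP dP PE] [mQ dQ QE]; rewrite -{}PE -{}QE in EE' *.
have PQ a b : (P a).1 `&` (Q b).1 = set0.
  rewrite -subset0 => x [Px Qx]; rewrite -EE'.
  by split; [exists a|exists b].
split.
- by move=> i; case: (split_ordP i) => a ->;
    rewrite ?cat_partition_lshift ?cat_partition_rshift.
- move=> i j; case: (split_ordP i) => a ->; case: (split_ordP j) => b ->;
    rewrite ?cat_partition_lshift ?cat_partition_rshift.
  + by rewrite (inj_eq (@lshift_inj _ _)); exact: dP.
  + by rewrite PQ measure0.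
  + by rewrite setIC PQ measure0.
  + by rewrite (inj_eq (@rshift_inj _ _)); exact: dQ.
- apply/seteqP; split=> x.
    move=> [i _]; case: (split_ordP i) => a ->;
    rewrite ?cat_partition_lshift ?cat_partition_rshift => h;
    by [left; exists a|right; exists a].
  move=> [[a _ h]|[a _ h]].
    by exists (lshift l a); rewrite ?cat_partition_lshift.
  by exists (rshift k a); rewrite ?cat_partition_rshift.
Qed.

Lemma fine_partition_cat gamma k l (P : 'I_k -> set (borel T) * T)
    (Q : 'I_l -> set (borel T) * T) :
  fine_partition gamma P -> fine_partition gamma Q ->
  fine_partition gamma (cat_partition P Q).
Proof.
move=> fP fQ i w; case: (split_ordP i) => a ->;
  rewrite ?cat_partition_lshift ?cat_partition_rshift.
  exact: fP.
exact: fQ.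
Qed.

Lemma partition_of_measure_le E k (P : 'I_k -> set (borel T) * T) i :
  measurable E -> partition_of mu E P -> fine (mu (P i).1) <= fine (mu E).
Proof.
move=> mE [mP _ PE]; apply: fine_le; [exact: fin_num_measure..|].
apply: le_measure; [exact: mem_set (mP i)|exact: mem_set|].
by move=> x Px; rewrite -PE; exists i.
Qed.

Definition gauge_min gamma gamma' (t : T) : R := Num.min (gamma t) (gamma' t).

Lemma gauge_fun_min gamma gamma' :
  gauge_fun gamma -> gauge_fun gamma' -> gauge_fun (gauge_min gamma gamma').
Proof. by move=> g g' t; rewrite lt_min g g'. Qed.

Lemma fine_partition_min gamma gamma' k (P : 'I_k -> set (borel T) * T) :
  fine_partition (gauge_min gamma gamma') P ->
  fine_partition gamma P /\ fine_partition gamma' P.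
Proof.
by move=> fP; split=> i w /fP; rewrite /gauge_min lt_min => /andP[].
Qed.

(** A finite subcover of [T] by interiors of balls is made disjoint and then intersected with [E].
    The tags come from the cover alone; sharing them among all [E] is what later gives absolute
    continuity. *)
Lemma fine_partition_exists gamma : compact [set: T] -> gauge_fun gamma ->
  exists k (t : 'I_k -> T), forall E, measurable E ->
    exists P : 'I_k -> set (borel T) * T,
      [/\ partition_of mu E P, fine_partition gamma P &
          forall i, (P i).2 = t i].
Proof.
rewrite compact_cover => cT g0.
have [|x _|D _ DT] := cT T setT (fun t => (ball t (gamma t))°).
- by move=> t _; exact: open_interior.
- by exists x => //; apply: nbhsx_ballx; exact: g0.
(* The default [point] extends the centres to a sequence on all naturals, as [seqDU] demands; the
   partition takes only indices below [size s]. *)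
pose s := enum_fset D; pose U (n : nat) : set (borel T) :=
  (ball (nth point s n) (gamma (nth point s n)))°.
have mU n : measurable (U n).
  by apply: sub_sigma_algebra; exact: open_interior.
exists (size s), (fun i => nth point s i) => E mE.
exists (fun i => (E `&` seqDU U i, nth point s i)); split => //=.
- split=> /=.
  + move=> i; apply: measurableI => //; apply: measurableD => //.
    exact: bigsetU_measurable.
  + move=> i j ij; rewrite setIACA setIid.
    rewrite (_ : seqDU U i `&` _ = set0) ?setI0 ?measure0//.
    apply: (@trivIsetP _ _ _ _).1 => //; exact: trivIset_seqDU.
  + rewrite -setI_bigcupr; apply/setIidPl => x _.
    have [t tD Ut] := DT x I.
    have ts : t \in s by [].
    have : (\big[setU/set0]_(n < size s) U n) x.
      rewrite -bigcup_mkord; exists (index t s); first by rewrite /= index_mem.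
      by rewrite /U nth_index.
    by rewrite bigsetU_seqDU -bigcup_mkord => -[j /= js Uj]; exists (Ordinal js).
- move=> i w [_ [Uw _]]; move/interior_subset: Uw.
  by rewrite ballEmdist/= metric_sym.
Qed.
End gauge_integral.

(** * Integrals of bounded functions over partitions with free tags *)

Section function_integral.
Context {R : realType} {T : pmetricType R}.
Variable mu : {finite_measure set (borel T) -> \bar R}.
Context {W : Type} (g : T -> W -> R).
Implicit Types (E : set (borel T)) (gamma : T -> R) (j : W -> R).

Definition function_sum {k} (P : 'I_k -> set (borel T) * T) (w : W) : R :=
  \sum_(i < k) fine (mu (P i).1) * g (P i).2 w.

(** The gauge is chosen before [w], so the sums converge uniformly in the parameter. *)
Definition is_gauge_integral E j :=
  forall eps : R, 0 < eps -> exists2 gamma, gauge_fun gamma &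
    forall k (P : 'I_k -> set (borel T) * T),
      partition_of mu E P -> fine_partition gamma P ->
      forall w, `|function_sum P w - j w| <= eps.

Lemma function_sum_cat k l (P : 'I_k -> set (borel T) * T)
    (Q : 'I_l -> set (borel T) * T) w :
  function_sum (cat_partition P Q) w = function_sum P w + function_sum Q w.
Proof.
rewrite /function_sum big_split_ord/=; congr (_ + _); apply: eq_bigr => i _.
  by rewrite cat_partition_lshift.
by rewrite cat_partition_rshift.
Qed.

Hypothesis compactT : compact [set: T].

Lemma fine_partition_exists1 gamma E : gauge_fun gamma -> measurable E ->
  exists k (P : 'I_k -> set (borel T) * T),
    partition_of mu E P /\ fine_partition gamma P.
Proof.
move=> g0 mE; have [k [t /(_ E mE) [P [pP fP _]]]] :=
  fine_partition_exists mu gamma compactT g0.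
by exists k, P.
Qed.

(** Partitions of [E] and [E'] fine for all three gauges are concatenated; the sum splits
    accordingly and each integral contributes an error of [e / 3]. *)
Lemma is_gauge_integralU E E' j j' j'' :
  measurable E -> measurable E' -> E `&` E' = set0 ->
  is_gauge_integral E j -> is_gauge_integral E' j' ->
  is_gauge_integral (E `|` E') j'' -> forall w, j'' w = j w + j' w.
Proof.
move=> mE mE' EE' hj hj' hj'' w; apply/eqP; rewrite -subr_eq0 -normr_le0.
apply/ler_addgt0Pl => e e0; rewrite addr0.
have e30 : 0 < e / 3 by rewrite divr_gt0.
have [c1 c10 h1] := hj _ e30; have [c2 c20 h2] := hj' _ e30.
have [c3 c30 h3] := hj'' _ e30.
pose c := gauge_min (gauge_min c1 c2) c3.
have c0 : gauge_fun c by do 2 apply: gauge_fun_min => //.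
have [k [P [pP /fine_partition_min[/fine_partition_min[fP1 _] fP3]]]] :=
  fine_partition_exists1 c E c0 mE.
have [l [Q [pQ /fine_partition_min[/fine_partition_min[_ fQ2] fQ3]]]] :=
  fine_partition_exists1 c E' c0 mE'.
have := h3 _ _ (partition_of_cat mu _ _ _ _ _ _ EE' pP pQ)
  (fine_partition_cat _ _ _ _ _ fP3 fQ3) w.
have := h1 _ _ pP fP1 w; have := h2 _ _ pQ fQ2 w.
rewrite function_sum_cat !ler_norml => /andP[? ?] /andP[? ?] /andP[? ?].
by apply/andP; split; lra.
Qed.

Variables (J : W -> R) (intJ : is_gauge_integral setT J).

(** Both partitions of [E] are completed by the same fine partition of the complement, whose sum
    cancels; both totals are near [J]. The gauge therefore does not depend on [E]. *)
Lemma function_sum_cauchy (eps : R) : 0 < eps ->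
  exists2 gamma, gauge_fun gamma & forall E, measurable E ->
    forall k l (P : 'I_k -> set (borel T) * T) (Q : 'I_l -> set (borel T) * T),
      partition_of mu E P -> fine_partition gamma P ->
      partition_of mu E Q -> fine_partition gamma Q ->
      forall w, `|function_sum P w - function_sum Q w| <= eps.
Proof.
move=> e0; have e20 : 0 < eps / 2 by rewrite divr_gt0.
have [c c0 h] := intJ _ e20; exists c => // E mE k l P Q pP fP pQ fQ w.
have [m [S [pS fS]]] := fine_partition_exists1 c (~` E) c0 (measurableC mE).
have EC : E `&` ~` E = set0 by rewrite setICr.
have pPS := partition_of_cat mu _ _ _ _ _ _ EC pP pS.
have pQS := partition_of_cat mu _ _ _ _ _ _ EC pQ pS.
rewrite setUCr in pPS pQS.
have := h _ _ pPS (fine_partition_cat _ _ _ _ _ fP fS) w.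
have := h _ _ pQS (fine_partition_cat _ _ _ _ _ fQ fS) w.
rewrite !function_sum_cat !ler_norml => /andP[? ?] /andP[? ?].
by apply/andP; split; lra.
Qed.

(** The gauges index a filter base of Riemann sums, so that completeness of [R] supplies a limit at
    each [w]. *)
Definition sum_filter E (w : W) : set_system R :=
  filter_from gauge_fun (fun gamma =>
    [set s | exists k (P : 'I_k -> set (borel T) * T),
      [/\ partition_of mu E P, fine_partition gamma P & s = function_sum P w]]).

Lemma sum_filter_proper E w : measurable E -> ProperFilter (sum_filter E w).
Proof.
move=> mE; apply: filter_from_proper.
  apply: filter_from_filter; first by exists (fun=> 1) => t.
  move=> c1 c2 c10 c20; exists (gauge_min c1 c2); first exact: gauge_fun_min.
  by move=> _ [k [P [pP /fine_partition_min[f1 f2] ->]]]; split; exists k, P.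
move=> c c0; have [k [P [pP fP]]] := fine_partition_exists1 c E c0 mE.
by exists (function_sum P w), k, P.
Qed.

Lemma sum_filter_cvg E w : measurable E -> cvg (sum_filter E w).
Proof.
move=> mE; have PF := sum_filter_proper E w mE.
apply/cauchy_cvgP/cauchy_exP => e e0.
have e20 : 0 < e / 2 by rewrite divr_gt0.
have [c c0 h] := function_sum_cauchy _ e20.
have [k [P [pP fP]]] := fine_partition_exists1 c E c0 mE.
exists (function_sum P w); exists c => // _ [l [Q [pQ fQ ->]]].
rewrite -ball_normE/=; apply: le_lt_trans (h E mE _ _ _ _ pP fP pQ fQ w) _.
by rewrite ltr_pdivrMr// ltr_pMr// ltr1n.
Qed.

Lemma is_gauge_integral_exists E : measurable E ->
  exists j, is_gauge_integral E j.
Proof.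
move=> mE; exists (fun w => lim (sum_filter E w)) => e e0.
have [c c0 h] := function_sum_cauchy _ e0; exists c => // k P pP fP w.
have PF := sum_filter_proper E w mE.
(* The Cauchy estimate passes to the limit in [Q] because closed balls are closed; [c] stays
   independent of [w]. *)
apply: (@closed_cvg _ R (sum_filter E w) PF id
  [set s | `|function_sum P w - s| <= e]); last exact: sum_filter_cvg.
- rewrite (_ : mkset _ = (closed_ball (function_sum P w) e)).
    exact: closed_ball_closed.
  by rewrite closed_ballE.
- by exists c => // _ [l [Q [pQ fQ ->]]]; exact: (h E mE _ _ _ _ pP fP pQ fQ w).
Qed.

Hypothesis g_bounded : forall t, exists K, forall w, `|g t w| <= K.

(** With tags fixed before [E], the sum over [P] is at most [mu E] times the sum of the bounds of
    [g] at these tags. The other two thirds of [eps] pay for passing from [P] to a finer [Q]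
    depending on [j], and from [Q] to [j]. *)
Lemma is_gauge_integral_abs_continuous (eps : R) : 0 < eps ->
  exists2 delta : R, 0 < delta & forall E j, measurable E ->
    (mu E < delta%:E)%E -> is_gauge_integral E j -> forall w, `|j w| <= eps.
Proof.
move=> e0; have e30 : 0 < eps / 3 by rewrite divr_gt0.
have [c c0 h] := function_sum_cauchy _ e30.
have [k [t ht]] := fine_partition_exists mu c compactT c0.
pose K i := sval (cid (g_bounded (t i))).
have gK i w : `|g (t i) w| <= K i by rewrite /K; case: cid.
have K0 : 0 <= \sum_i `|K i| by apply: sumr_ge0.
(* The summand 1 keeps the denominator positive when all bounds vanish. *)
exists (eps / 3 / (1 + \sum_i `|K i|)).
  by rewrite divr_gt0// ltr_pwDl.
move=> E j mE muE intj w.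
have [c' c'0 h'] := intj _ e30.
have [P [pP fP tP]] := ht E mE.
have [l [Q [pQ /fine_partition_min[fQ fQ']]]] :=
  fine_partition_exists1 _ E (gauge_fun_min _ _ c0 c'0) mE.
have SP : `|function_sum P w| <= eps / 3.
  have : fine (mu E) <= eps / 3 / (1 + \sum_i `|K i|).
    by rewrite -lee_fin fineK ?fin_num_measure// ltW.
  rewrite ler_pdivlMr ?ltr_pwDl// => muEK; apply: le_trans muEK.
  apply: le_trans (ler_norm_sum _ _ _) _.
  rewrite mulrDr mulr1; apply: ler_wpDl; first exact/fine_ge0/measure_ge0.
  rewrite mulr_sumr; apply: ler_sum => i _.
  rewrite normrM ger0_norm; last exact/fine_ge0/measure_ge0.
  rewrite tP; apply: ler_pM => //; first exact/fine_ge0/measure_ge0.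
    exact: (partition_of_measure_le mu E _ P).
  by apply: le_trans (gK i w) _; rewrite ler_norm.
have := h E mE _ _ _ _ pP fP pQ fQ w; have := h' _ _ pQ fQ' w.
move: SP; rewrite !ler_norml => /andP[? ?] /andP[? ?] /andP[? ?].
by apply/andP; split; lra.
Qed.

End function_integral.

(** * The embedding of cwk(X) and the integral of F *)

Section distances.
Context {R : realType} {X : normedModType R}.
Implicit Types (A C : set X) (e : R).

Lemma minkowski_scale1 A : minkowski_scale 1 A = A.
Proof.
apply/seteqP; split=> [_ [x Ax <-]|x Ax]; first by rewrite scale1r.
by exists x => //; rewrite scale1r.
Qed.

Lemma minkowski_add0 A : minkowski_add A [set 0] = A.
Proof.
apply/seteqP; split=> [_ [x Ax [_ -> <-]]|x Ax]; first by rewrite addr0.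
by exists x => //; exists 0 => //; rewrite addr0.
Qed.

Lemma set_dist_lt_ex (z : X) C e : (set_dist z C < e%:E)%E ->
  exists2 c, C c & `|z - c| < e.
Proof. by move=> /ereal_inf_lt[_ [c Cc <-]]; rewrite lte_fin; exists c. Qed.

Lemma hausdorff_dist_leP A C e : (hausdorff_dist A C <= e%:E)%E <->
  (forall a, A a -> (set_dist a C <= e%:E)%E) /\
  (forall c, C c -> (set_dist c A <= e%:E)%E).
Proof.
rewrite /hausdorff_dist ge_max; split.
  move=> /andP[/ereal_supP hA /ereal_supP hC].
  by split=> [a Aa|c Cc]; [apply: hA; exists a|apply: hC; exists c].
move=> [hA hC]; apply/andP; split; apply: ge_ereal_sup => _ [x + <-].
  exact: hA.
exact: hC.
Qed.

Lemma closed_norm_approx A (z : X) : closed A ->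
  (forall e, 0 < e -> exists2 a, A a & `|z - a| < e) -> A z.
Proof.
move=> cA h; apply: cA => B /nbhs_ballP[e /= e0 zB].
have [a Aa za] := h _ e0; exists a; split=> //; apply: zB.
by rewrite -ball_normE.
Qed.

Lemma hausdorff_dist0_subset A C : closed C ->
  (hausdorff_dist A C <= 0%:E)%E -> A `<=` C.
Proof.
move=> cC /hausdorff_dist_leP[h _] a Aa; apply: closed_norm_approx => // e e0.
by apply: set_dist_lt_ex; apply: le_lt_trans (h _ Aa) _; rewrite lte_fin.
Qed.

End distances.

Lemma sup_norm_ge0 {R : realType} {Omega : topologicalType} (f : Omega -> R) :
  0 <= sup_norm f.
Proof.
have [[[_ [w _ _]] ubS]|/sup_out fS] := pselect (has_sup (range (fun w => `|f w|)));
  last by rewrite /sup_norm fS.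
by apply: (@le_trans _ _ `|f w|) => //; apply: ub_le_sup => //; exists w.
Qed.

Section embedding_cwk.
Context {R : realType} {X : normedModType R} {Omega : topologicalType}.
Variable i : set X -> continuousType Omega R.
Hypotheses (compactOmega : compact [set: Omega]) (embi : embedding i).
Implicit Types A C : set X.

(** Compactness bounds the range, so [sup] is a true supremum when [Omega] is non-empty; on the
    empty space it defaults to 0, which [0 <= e] covers. *)
Lemma sup_norm_leP (f : Omega -> R) (e : R) : continuous f -> 0 <= e ->
  (sup_norm f <= e) <-> (forall w, `|f w| <= e).
Proof.
move=> cf e0; split=> [fe w|fe].
  apply: le_trans fe; apply: ub_le_sup; last by exists w.
  have : compact (range f).
    by apply: continuous_compact compactOmega; exact: continuous_subspaceT.
  move=> /(@compact_bounded _ R)[M [_ hM]]; exists (M + 1) => _ [v _ <-].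
  by apply: hM; [rewrite ltrDl|exists v].
have [[w _]|Om0] := pselect ([set: Omega] !=set0).
  by apply: ge_sup; [exists `|f w|, w|move=> _ [v _ <-]; exact: fe].
rewrite /sup_norm sup_out// => -[[_ [v _ _]] _].
by apply: Om0; exists v.
Qed.

Lemma embedding_sub_continuous A C : continuous (fun w => i A w - i C w).
Proof. by move=> w; apply: (@cvgB _ R); exact: (@cts_fun _ _ (i _)). Qed.

Lemma embedding_distP A C (e : R) : cwk A -> cwk C -> 0 <= e ->
  (hausdorff_dist A C <= e%:E)%E <-> (forall w, `|i A w - i C w| <= e).
Proof.
move=> cA cC e0; have [_ iH _ _] := embi.
by rewrite iH// lee_fin; apply: sup_norm_leP => //; exact: embedding_sub_continuous.
Qed.

Lemma embedding_inj A C : cwk A -> cwk C -> i A =1 i C -> A = C.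
Proof.
move=> cA cC iAC; have h w : `|i A w - i C w| <= 0 by rewrite iAC subrr normr0.
have h' w : `|i C w - i A w| <= 0 by rewrite iAC subrr normr0.
apply/seteqP; split; apply: hausdorff_dist0_subset;
  solve [exact: cwk_closed | exact/embedding_distP].
Qed.

Lemma embedding_scale_add A C (a : R) w : cwk A -> cwk C -> 0 <= a ->
  i (minkowski_add (minkowski_scale a A) C) w = a * i A w + i C w.
Proof.
move=> cA cC a0; have [iL _ _ _] := embi.
by rewrite -{1}(minkowski_scale1 C) (iL _ _ _ _ cA cC a0 ler01) mul1r.
Qed.

Lemma embedding_add A C w : cwk A -> cwk C ->
  i (minkowski_add A C) w = i A w + i C w.
Proof.
by move=> cA cC; rewrite -{1}(minkowski_scale1 A) embedding_scale_add// mul1r.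
Qed.

(** Since [{0} + {0} = {0}], the value equals its own double. *)
Lemma embedding0 w : i [set 0] w = 0.
Proof.
have := embedding_add [set 0] [set 0] w (cwk_set1 _) (cwk_set1 _).
rewrite minkowski_add0 => /eqP; rewrite -subr_eq0 opprD addNKr oppr_eq0.
by move/eqP.
Qed.

(** The norm of [x] is its distance to [{0}], which the Hausdorff distance from [A] to [{0}]
    dominates. *)
Lemma cwk_norm_le A (e : R) x : cwk A -> (forall w, `|i A w| <= e) -> 0 <= e ->
  A x -> `|x| <= e.
Proof.
move=> cA iA e0 Ax.
have /embedding_distP h : forall w, `|i A w - i [set 0] w| <= e.
  by move=> w; rewrite embedding0 subr0.
have [hA _] := (hausdorff_dist_leP _ _ _).1 (h cA (cwk_set1 _) e0).
apply/ler_addgt0Pl => d d0.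
have [|_ ->] := set_dist_lt_ex x [set 0] (d + e).
  by apply: le_lt_trans (hA _ Ax) _; rewrite lte_fin ltrDr.
by rewrite subr0 => /ltW.
Qed.

Lemma embedding_bounded A : exists K, forall w, `|i A w| <= K.
Proof.
exists (Num.max 0 (sup_norm (i A))).
by apply/sup_norm_leP; rewrite ?le_max ?lexx ?orbT//; exact: (@cts_fun _ _ (i A)).
Qed.

Lemma uniform_approx_continuous (j : Omega -> R) :
  (forall e, 0 < e -> exists2 A, cwk A & forall w, `|i A w - j w| <= e) ->
  continuous j.
Proof.
move=> h w; apply/(@cvgrPdist_le _ R) => e e0.
have e30 : 0 < e / 3 by rewrite divr_gt0.
have [A _ hA] := h _ e30.
have /(@cvgrPdist_le _ R)/(_ _ e30) := @cts_fun _ _ (i A) w.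
apply: filterS => v; have := hA w; have := hA v.
rewrite !ler_norml => /andP[? ?] /andP[? ?] /andP[? ?].
by apply/andP; split; lra.
Qed.

(** As a uniform limit [j] is continuous, hence a member of [C(Omega)] to which the norm closedness
    of the image of [i] applies. *)
Lemma embedding_complete (j : Omega -> R) :
  (forall e, 0 < e -> exists2 A, cwk A & forall w, `|i A w - j w| <= e) ->
  exists2 A, cwk A & i A =1 j.
Proof.
move=> h; have jc := uniform_approx_continuous _ h.
pose jC := isContinuous.Build Omega R j jc.
pose f : continuousType Omega R := HB.pack j jC.
have [_ _ iC _] := embi.
have [|A cA iA] := iC f.
  move=> e e0; have e20 : 0 < e / 2 by rewrite divr_gt0.
  have [A cA hA] := h _ e20; exists A => //.
  apply: (@le_lt_trans _ _ (e / 2)); last by lra.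
  apply/sup_norm_leP; [|exact: ltW|by move=> w; rewrite distrC; exact: hA].
  by move=> w; apply: (@cvgB _ R); [exact: jc|exact: (@cts_fun _ _ (i A))].
by exists A => // w; rewrite iA.
Qed.

(** * The integral of [F] as a limit of embedded Riemann sums *)

Context {T : pmetricType R} (mu : {finite_measure set (borel T) -> \bar R}).
Variable F : T -> set X.
Hypotheses (compactT : compact [set: T]) (cwkF : forall t, cwk (F t)).
Hypothesis intF : H_integrable mu F.

Let g (t : T) (w : Omega) : R := i (F t) w.

(** The masses of the pieces are nonnegative, so positive linearity of [i] applies one summand at a
    time. *)
Lemma riemann_sum_embedding k (P : 'I_k -> set (borel T) * T) :
  cwk (riemann_sum mu F P) /\
  forall w, i (riemann_sum mu F P) w = function_sum mu g P w.
Proof.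
rewrite /riemann_sum /function_sum; elim: k P => [|k IH] P.
  rewrite big_ord0; split; first exact: cwk_set1.
  by move=> w; rewrite big_ord0 embedding0.
rewrite big_ord_recl; have [cS iS] := IH (fun j => P (lift ord0 j)).
split; first by apply: cwk_minkowski_add cS; exact: cwk_minkowski_scale.
move=> w; rewrite big_ord_recl embedding_scale_add// ?iS//.
exact/fine_ge0/measure_ge0.
Qed.

Lemma is_gauge_integral_setT :
  exists J : Omega -> R, is_gauge_integral mu g setT J.
Proof.
have [J cJ h] := intF; exists (i J) => e e0.
have [c c0 hc] := h _ e0; exists c => // k P pP fP w.
have [cS <-] := riemann_sum_embedding _ P.
by move: w; apply/embedding_distP; [exact: cS|exact: cJ|exact: ltW|exact: hc].
Qed.

(** The limit [j] of the embedded sums is the image of some [A] in [cwk], and [Phi] is identified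
    with this [A] by two inclusions. *)
Lemma Phi_gauge_integral (E : set (borel T)) : measurable E ->
  cwk (Phi mu F E) /\ is_gauge_integral mu g E (i (Phi mu F E)).
Proof.
move=> mE; have [J hJ] := is_gauge_integral_setT.
have [j hj] := is_gauge_integral_exists mu g compactT J hJ E mE.
have [A cA iA] : exists2 A, cwk A & i A =1 j.
  apply: embedding_complete => e e0; have [c c0 h] := hj _ e0.
  have [k [P [pP fP]]] := fine_partition_exists1 mu compactT c E c0 mE.
  have [cS iS] := riemann_sum_embedding _ P.
  by exists (riemann_sum mu F P) => // w; rewrite iS; exact: h.
have hA e : 0 < e -> exists2 c, gauge_fun c &
    forall k (P : 'I_k -> set (borel T) * T),
    partition_of mu E P -> fine_partition c P ->
    (hausdorff_dist (riemann_sum mu F P) A <= e%:E)%E.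
  move=> e0; have [c c0 h] := hj _ e0; exists c => // k P pP fP.
  have [cS iS] := riemann_sum_embedding _ P.
  by apply/embedding_distP => // [|w]; [exact: ltW|rewrite iS iA; exact: h].
suff -> : Phi mu F E = A.
  split=> // e e0; have [c c0 h] := hj _ e0; exists c => // k P pP fP w.
  by rewrite iA; exact: h.
apply/seteqP; split=> [z Phiz|z Az e e0]; last first.
  have [c c0 h] := hA _ e0; exists c => // k P pP fP.
  by have /hausdorff_dist_leP[_] := h _ _ pP fP; apply.
(* A point of [Phi] is near a Riemann sum fine for both gauges, and that sum is near the closed set
   [A]. *)
apply: closed_norm_approx; first exact: cwk_closed.
move=> e e0; have e30 : 0 < e / 3 by rewrite divr_gt0.
(* The infimum defining [set_dist] need not be attained; the strict gap yields an actual point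
   within [e / 2]. *)
have e3 : e / 3 < e / 2 by lra.
have [c1 c10 h1] := Phiz _ e30; have [c2 c20 h2] := hA _ e30.
have [k [P [pP /fine_partition_min[f1 f2]]]] :=
  fine_partition_exists1 mu compactT _ E (gauge_fun_min _ _ c10 c20) mE.
have [|s Ss zs] := set_dist_lt_ex z (riemann_sum mu F P) (e / 2).
  by apply: le_lt_trans (h1 _ _ pP f1) _; rewrite lte_fin.
have /hausdorff_dist_leP[/(_ _ Ss) sA _] := h2 _ _ pP f2.
have [|a Aa sa] := set_dist_lt_ex s A (e / 2).
  by apply: le_lt_trans sA _; rewrite lte_fin.
exists a => //; rewrite -(subrKA s); apply: le_lt_trans (ler_normD _ _) _.
by rewrite (splitr e) ltrD.
Qed.

(** Both sides have the same image under [i], which is injective on [cwk]. *)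
Lemma PhiU (E E' : set (borel T)) : measurable E -> measurable E' ->
  E `&` E' = set0 ->
  Phi mu F (E `|` E') = minkowski_add (Phi mu F E) (Phi mu F E').
Proof.
move=> mE mE' EE'; have [cE iE] := Phi_gauge_integral _ mE.
have [cE' iE'] := Phi_gauge_integral _ mE'.
have [cU iU] := Phi_gauge_integral _ (measurableU _ _ mE mE').
apply: embedding_inj => //; first exact: cwk_minkowski_add.
move=> w; rewrite embedding_add//.
exact: (is_gauge_integralU mu g compactT _ _ _ _ _ mE mE' EE' iE iE' iU w).
Qed.

Lemma Phi_abs_continuous (e : R) : 0 < e -> exists2 delta : R, 0 < delta &
  forall E : set (borel T), measurable E -> (mu E < delta%:E)%E ->
    forall w, `|i (Phi mu F E) w| <= e.
Proof.
move=> e0; have [J hJ] := is_gauge_integral_setT.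
have [|d d0 h] := is_gauge_integral_abs_continuous mu g compactT J hJ _ e e0.
  by move=> t; exact: embedding_bounded.
by exists d => // E mE muE; apply: (h E) => //; exact: (Phi_gauge_integral _ mE).2.
Qed.

End embedding_cwk.

(** * From additivity and absolute continuity to sigma-additivity *)

Section tails.
Context {R : realType} {d : measure_display} {T : measurableType d}.
Implicit Type E : nat -> set T.

Definition block E m n : set T := \bigcup_(k in [set k | (m <= k < n)%N]) E k.
Definition tail E m : set T := \bigcup_(k in [set k | (m <= k)%N]) E k.

Lemma block_measurable E m n : (forall k, measurable (E k)) ->
  measurable (block E m n).
Proof. by move=> mE; apply: bigcup_measurable. Qed.

Lemma tail_measurable E m : (forall k, measurable (E k)) ->
  measurable (tail E m).
Proof. by move=> mE; apply: bigcup_measurable. Qed.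

Lemma block_tail E m n : block E m n `<=` tail E m.
Proof. by move=> x [k /andP[mk _] Ek]; exists k. Qed.

Lemma blockn E m : block E m m = set0.
Proof. by rewrite -subset0 => x [k /= mkm _]; lia. Qed.

Lemma tail0 E : tail E 0 = \bigcup_k E k.
Proof. by apply/seteqP; split=> x [k _ Ek]; exists k. Qed.

Lemma blockS E m n : (m <= n)%N -> block E m n.+1 = block E m n `|` E n.
Proof.
move=> mn; apply/seteqP; split=> x.
  move=> [k /= mkn Ek]; have [kn|kn] := eqVneq k n; first by right; rewrite -kn.
  by left; exists k => //=; lia.
move=> [[k /= mkn Ek]|En]; first by exists k => //=; lia.
by exists n => //=; lia.
Qed.

Lemma tail_split E n : tail E 0 = block E 0 n `|` tail E n.
Proof.
apply/seteqP; split=> x.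
  move=> [k _ Ek]; have [kn|nk] := ltnP k n; first by left; exists k.
  by right; exists k.
by move=> [[k _ Ek]|[k _ Ek]]; exists k.
Qed.

Lemma tailS E n : tail E n = E n `|` tail E n.+1.
Proof.
apply/seteqP; split=> x.
  move=> [k /= nk Ek]; have [kn|kn] := eqVneq k n; first by left; rewrite -kn.
  by right; exists k => //=; lia.
move=> [En|[k /= nk Ek]]; first by exists n => /=.
by exists k => //=; lia.
Qed.

Section disjoint.
Variables (E : nat -> set T) (tE : trivIset setT E).

Let same k l x : E k x -> E l x -> k = l.
Proof. by move=> Ek El; apply: tE => //; exists x. Qed.

Lemma block_disjoint m n : block E m n `&` E n = set0.
Proof.
by rewrite -subset0 => x [[k /= mkn Ek] En]; have := same _ _ _ Ek En; lia.
Qed.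

Lemma block_tail_disjoint m n : block E m n `&` tail E n = set0.
Proof.
rewrite -subset0 => x [[k /= mkn Ek] [l /= nl El]].
by have := same _ _ _ Ek El; lia.
Qed.

Lemma tail_disjoint n : E n `&` tail E n.+1 = set0.
Proof. by rewrite -subset0 => x [En [l /= nl El]]; have := same _ _ _ En El; lia. Qed.

Lemma bigcap_tail : \bigcap_n tail E n = set0.
Proof.
rewrite -subset0 => x tx; have [k _ Ek] := tx 0 I.
by have [l /= kl El] := tx k.+1 I; have := same _ _ _ Ek El; lia.
Qed.

(** By disjointness the tails decrease to the empty set, and a finite measure is continuous from
    above. *)
Lemma tail_measure_small (mu : {finite_measure set T -> \bar R}) (e : R) :
  (forall k, measurable (E k)) -> 0 < e ->
  exists N, forall n, (N <= n)%N -> (mu (tail E n) < e%:E)%E.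
Proof.
move=> mE e0.
have : mu \o tail E @ \oo --> mu (\bigcap_n tail E n).
  apply: nonincreasing_cvg_mu.
  - by rewrite ltey_eq fin_num_measure//; exact: tail_measurable.
  - by move=> n; exact: tail_measurable.
  - by rewrite bigcap_tail.
  - move=> m n mn; apply/subsetPset => x [k /= nk Ek].
    by exists k => //=; exact: leq_trans nk.
rewrite bigcap_tail measure0 => /fine_cvgP[_ /(@cvgrPdist_lt _ R)/(_ _ e0)].
move=> [N _ hN]; exists N => n /hN /=; rewrite sub0r normrN => h.
have fin : mu (tail E n) \is a fin_num.
  by apply: fin_num_measure; exact: tail_measurable.
rewrite -(fineK fin) lte_fin; apply: le_lt_trans h; exact: ler_norm.
Qed.

End disjoint.
End tails.

(** * Additive and absolutely continuous set-valued maps *)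

Section additive_abs_continuous.
Context {R : realType} {d : measure_display} {T : measurableType d}.
Context {X : completeNormedModType R} (mu : {finite_measure set T -> \bar R}).
Variable M : set T -> set X.
Hypothesis cwkM : forall E, measurable E -> cwk (M E).
Hypothesis MU : forall E E', measurable E -> measurable E' -> E `&` E' = set0 ->
  M (E `|` E') = minkowski_add (M E) (M E').
Hypothesis M_abs_continuous : forall e : R, 0 < e ->
  exists2 delta : R, 0 < delta & forall E, measurable E ->
    (mu E < delta%:E)%E -> forall x, M E x -> `|x| <= e.

(** The empty set has measure below every [delta], so its elements have norm below every positive
    bound. *)
Lemma multimeasure_set0 : M set0 = [set 0].
Proof.
have M00 x : M set0 x -> x = 0.
  move=> Mx; apply/eqP; rewrite -normr_le0; apply/ler_addgt0Pl => e e0.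
  have [c c0 h] := M_abs_continuous _ e0; rewrite addr0.
  by apply: (h set0) => //; rewrite measure0 lte_fin.
have [[x Mx] _ _] := cwkM _ measurable0.
by apply/seteqP; split=> [y /M00 //|_ ->]; rewrite -(M00 _ Mx).
Qed.

Section sequence.
Variables (E : nat -> set T) (mE : forall n, measurable (E n)).
Hypothesis tE : trivIset setT E.

Lemma multimeasure_block (x : nat -> X) m n : (forall k, M (E k) (x k)) ->
  (m <= n)%N -> M (block E m n) (\sum_(m <= k < n) x k).
Proof.
move=> Mx; elim: n => [|n IH].
  by rewrite leqn0 => /eqP ->; rewrite blockn big_geq// multimeasure_set0.
rewrite leq_eqVlt => /orP[/eqP ->|mn].
  by rewrite blockn big_geq// multimeasure_set0.
rewrite big_nat_recr//= blockS// MU//; last 2 first.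
- exact: block_measurable.
- exact: block_disjoint.
by exists (\sum_(m <= k < n) x k); [exact: IH|exists (x n)].
Qed.

(** One [N] serves all measurable subsets of the tail, hence blocks as well as tails. *)
Lemma multimeasure_tail_small (e : R) : 0 < e ->
  exists N, forall n A x, (N <= n)%N -> measurable A -> A `<=` tail E n ->
    M A x -> `|x| <= e.
Proof.
move=> e0; have [c c0 h] := M_abs_continuous _ e0.
have [N hN] := tail_measure_small _ tE mu _ mE c0.
exists N => n A x Nn mA An; apply: h => //.
apply: le_lt_trans (hN n Nn); apply: le_measure => //; apply: mem_set => //.
exact: tail_measurable.
Qed.

Lemma multimeasure_series_cvg (x : nat -> X) : (forall k, M (E k) (x k)) ->
  cvgn (series x).
Proof.
move=> Mx; apply/cauchy_cvgP/cauchy_seriesP => e e0.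
have e20 : 0 < e / 2 by rewrite divr_gt0.
have [N hN] := multimeasure_tail_small _ e20.
(* Only the lower index must be large: for [n <= m] the sum is empty, otherwise it belongs to [M] of
   a block inside the tail. *)
exists ([set n | (N <= n)%N], setT);
  first by split; [exact: nbhs_infty_ge|exact: filterT].
move=> [m n] [/= Nm _]; have [mn|nm] := leqP m n; last first.
  by rewrite big_geq ?normr0// ltnW.
apply: (@le_lt_trans _ _ (e / 2)); last by lra.
apply: (hN m (block E m n)) => //; [exact: block_measurable|exact: block_tail|].
exact: multimeasure_block.
Qed.

(** A partial sum plus any [y] in [M] of the tail lies in [M] of the union. Both [y] and the
    remainder of the series are small, and the set is closed. *)
Lemma multimeasure_series_mem (x : nat -> X) : (forall k, M (E k) (x k)) ->
  M (\bigcup_n E n) (limn (series x)).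
Proof.
move=> Mx; rewrite -tail0.
apply: closed_norm_approx;
  first by apply: cwk_closed; apply: cwkM; exact: tail_measurable.
move=> e e0; have e30 : 0 < e / 3 by rewrite divr_gt0.
have [N hN] := multimeasure_tail_small _ e30.
have /(@cvgrPdist_le _ X)/(_ _ e30)[N' _ hN'] := multimeasure_series_cvg _ Mx.
pose n := maxn N N'.
have [[y My] _ _] := cwkM _ (tail_measurable E n mE).
have ye := hN n _ _ (leq_maxl _ _) (tail_measurable E n mE) (@subset_refl _ _) My.
exists (series x n + y).
  rewrite (tail_split E n) MU; first 1 last.
  - exact: block_measurable.
  - exact: tail_measurable.
  - exact: block_tail_disjoint.
  by exists (series x n); [exact: multimeasure_block|exists y].
rewrite opprD addrA; apply: le_lt_trans (ler_normB _ _) _.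
by have /= := hN' n (leq_maxr _ _); lra.
Qed.

(** The premise stands under the existential so that [choice] yields a step on all pairs; outside
    [M (tail E n)] the witness 0 is a dummy. *)
Lemma multimeasure_tail_peel n r : exists y, M (tail E n) r ->
  M (tail E n.+1) y /\ M (E n) (r - y).
Proof.
have [Mr|nMr] := pselect (M (tail E n) r); last by exists 0.
move: Mr; rewrite tailS MU//; last 2 first.
- exact: tail_measurable.
- exact: tail_disjoint.
by move=> [u Mu [v Mv <-]]; exists v => _; rewrite addrK.
Qed.

(** Peeling [E n] off the tail produces remainders [r n] in [M (tail E n)]. Their differences are
    the selections, the series telescopes to [z - r n], and [r n] tends to 0. *)
Lemma multimeasure_series_ex z : M (\bigcup_n E n) z ->
  exists2 x : nat -> X, (forall n, M (E n) (x n)) & limn (series x) = z.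
Proof.
rewrite -tail0 => Mz.
have [step hstep] := @choice (nat * X)%type X (fun p y => M (tail E p.1) p.2 ->
    M (tail E p.1.+1) y /\ M (E p.1) (p.2 - y))
  (fun p => multimeasure_tail_peel p.1 p.2).
pose r := fix r n := if n is m.+1 then step (m, r m) else z.
have Mr n : M (tail E n) (r n) by elim: n => //= n /(hstep (n, r n))[].
pose x n := r n - r n.+1.
exists x; first by move=> n; exact: (hstep (n, r n) (Mr n)).2.
have sx n : series x n = z - r n.
  rewrite /series/=; elim: n => [|n IH]; first by rewrite big_geq// subrr.
  by rewrite big_nat_recr//= IH /x addrA subrK.
apply/cvg_lim => //; apply/(@cvgrPdist_le _ X) => e e0.
have [N hN] := multimeasure_tail_small _ e0.
exists N => // n /= Nn; rewrite sx opprB addrC subrK.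
by apply: (hN n _ _ Nn (tail_measurable E n mE) (@subset_refl _ _)); exact: Mr.
Qed.

End sequence.

Lemma additive_multimeasure : multimeasure M.
Proof.
split=> // [|E mE tE]; first exact: multimeasure_set0.
split=> [x Mx p bp|].
  (* The rearranged sets are again disjoint, so the convergence result applies to them directly. *)
  apply: (multimeasure_series_cvg (E \o p)) => [n|i j _ _ /= Eij|n]; first exact: mE.
    by apply: (bij_inj bp); exact: tE.
  exact: Mx.
apply/seteqP; split=> [z /(multimeasure_series_ex _ mE tE)[x Mx <-]|_ [x Mx <-]].
  by exists x.
exact: multimeasure_series_mem.
Qed.

Context {Omega : topologicalType} (i : set X -> continuousType Omega R).
Hypotheses (compactOmega : compact [set: Omega]) (embi : embedding i).
Hypothesis iM_abs_continuous : forall e : R, 0 < e ->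
  exists2 delta : R, 0 < delta & forall E, measurable E ->
    (mu E < delta%:E)%E -> forall w, `|i (M E) w| <= e.

Lemma embedding_abs_continuous :
  sup_norm_abs_continuous mu (fun E => i (M E)).
Proof.
move=> e e0; have e20 : 0 < e / 2 by rewrite divr_gt0.
have [c c0 h] := iM_abs_continuous _ e20; exists c => // E mE muE.
apply: (@le_lt_trans _ _ (e / 2)); last by lra.
by apply/sup_norm_leP; [|exact: (@cts_fun _ _ (i _))|exact: ltW|exact: h].
Qed.

(** By additivity the error after [n] terms is exactly the image of [M (tail E n)], whose measure
    tends to 0. *)
Lemma embedding_sigma_additive :
  sup_norm_sigma_additive (fun E => i (M E)).
Proof.
move=> E mE tE; apply/(@cvgrPdist_le _ R) => e e0.
have [c c0 h] := iM_abs_continuous _ e0.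
have [N hN] := tail_measure_small _ tE mu _ mE c0.
have iblock n w : i (M (block E 0 n)) w = \sum_(k < n) i (M (E k)) w.
  elim: n => [|n IH]; first by rewrite blockn multimeasure_set0 big_ord0 embedding0.
  have mB := block_measurable E 0 n mE.
  rewrite blockS// MU//; last exact: block_disjoint.
  by rewrite (embedding_add i embi)//; [rewrite IH big_ord_recr|exact: cwkM..].
exists N => // n /= Nn.
have mB := block_measurable E 0 n mE; have mt := tail_measurable E n mE.
rewrite (_ : (fun w => _) = i (M (tail E n))); last first.
  apply/funext => w; rewrite -tail0 (tail_split E n) MU//;
    last exact: block_tail_disjoint.
  rewrite (embedding_add i embi); [|exact: cwkM..].
  by rewrite iblock addrAC subrr add0r.
have cts := @cts_fun _ _ (i (M (tail E n))).
rewrite sub0r normrN ger0_norm ?sup_norm_ge0//.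
by apply/sup_norm_leP => //; [exact: ltW|exact: h (hN _ Nn)].
Qed.

End additive_abs_continuous.

(** * The multimeasure generated by an H-integrable multifunction *)

Theorem corollary3p7 (R : realType) (T : pmetricType R)
    (mu : {finite_measure set (borel T) -> \bar R})
    (X : completeNormedModType R)
    (Omega : topologicalType) (i : set X -> continuousType Omega R)
    (F : T -> set X)
    (compactT : compact [set: T])
    (mu_regular : regular_measure mu)
    (mu_nonatomic : pointwise_nonatomic mu)
    (compactOmega : compact [set: Omega])
    (hausdorffOmega : hausdorff_space Omega)
    (embedding_i : embedding i)
    (cwkF : forall t : T, cwk (F t))
    (H_integrableF : H_integrable mu F) :
  let M := Phi mu F in
  [/\ multimeasure M,
      sup_norm_sigma_additive (fun E : set (borel T) => i (M E)) &
      sup_norm_abs_continuous mu (fun E : set (borel T) => i (M E))].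
Proof.
move=> M.
have cwkM E : measurable E -> cwk (M E).
  by move=> mE; exact: (Phi_gauge_integral i compactOmega embedding_i mu F
    compactT cwkF H_integrableF E mE).1.
have MU := PhiU i compactOmega embedding_i mu F compactT cwkF H_integrableF.
have iM := Phi_abs_continuous i compactOmega embedding_i mu F compactT cwkF
  H_integrableF.
(* The bound on [i (M E)] is turned into a norm bound on the points of [M E], the form needed for
   series of selections. *)
have Mabs (e : R) : 0 < e -> exists2 delta : R, 0 < delta &
    forall E, measurable E -> (mu E < delta%:E)%E ->
    forall x, M E x -> `|x| <= e.
  move=> e0; have [delta delta0 h] := iM _ e0; exists delta => // E mE muE x.
  apply: (cwk_norm_le i compactOmega embedding_i) => //; last exact: ltW.
    exact: cwkM.
  exact: h.
split.
- exact: (additive_multimeasure mu M cwkM MU Mabs).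
- exact: (embedding_sigma_additive mu M cwkM MU Mabs i compactOmega
    embedding_i iM).
- exact: (embedding_abs_continuous mu M i compactOmega iM).
Qed.
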